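(* Let $\le_{\operatorname{int}}$ be an admissible total order on $\operatorname{int}(\mathbb{R})$ (i.e. a total order refining the Kulisch–Miranker partial order $\le_{KM}$), and let $\{\alpha_n\}_{n\in\mathbb{N}_0}$ be an upper dense sequence in $(0,1]$. Define $\Phi:\operatorname{IFN}_2(\mathbb{R})\to\operatorname{seq}(\operatorname{int}(\mathbb{R}))$ by interleaving the $\alpha$-cuts of the upper and lower membership functions: for $A=(\underline{A},\overline{A})\in\operatorname{IFN}_2(\mathbb{R})$, $$\Phi(A)=\{\overline{A}_{\alpha_0},\underline{A}_{\alpha_0},\overline{A}_{\alpha_1},\underline{A}_{\alpha_1},\dots\},$$ i.e. $\Phi(A)(2n)=\overline{A}_{\alpha_n}$ and $\Phi(A)(2n+1)=\underline{A}_{\alpha_n}$, where $\overline{A}_{\alpha_n}$ and $\underline{A}_{\alpha_n}$ are the $\alpha_n$-cuts of the fuzzy numbers $\overline{A}$ and $\underline{A}$. Then the $\Phi$-sequential binary relation $\le_\Phi$ is an admissible total order on $\operatorname{IFN}_2(\mathbb{R})$ with respect to $\le_{KY2}$; that is, it is a total order and $A\le_{KY2}B$ implies $A\le_\Phi B$ for all $A,B\in\operatorname{IFN}_2(\mathbb{R})$.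
   Context: $\operatorname{int}(\mathbb{R})=\{[a,b]:a,b\in\mathbb{R},\ a\le b\}$, and $[a,b]\le_{KM}[c,d]$ iff $a\le c$ and $b\le d$. A relation $\le_{\operatorname{int}}$ refines $\le_{KM}$ if $U\le_{KM}V$ implies $U\le_{\operatorname{int}}V$. A fuzzy set on $\mathbb{R}$ is a map $F:\mathbb{R}\to[0,1]$; for $\alpha\in(0,1]$ its $\alpha$-cut is $F_\alpha=\{x:F(x)\ge\alpha\}$, and $F_0$ is the closure of the support $\bigcup_{\alpha\in(0,1]}F_\alpha$. $F$ is a fuzzy number if $F_1\ne\emptyset$, $F_0$ is bounded, and $F_\alpha$ is a closed interval for each $\alpha\in(0,1]$. The Klir–Yuan partial order on fuzzy numbers is: $F\le_{KY}G$ iff $F_\alpha\le_{KM}G_\alpha$ for all $\alpha\in[0,1]$. An interval type-2 fuzzy number is a pair $A=(\underline{A},\overline{A})$ of fuzzy numbers with $\underline{A}(x)\le\overline{A}(x)$ for all $x\in\mathbb{R}$; $\operatorname{IFN}_2(\mathbb{R})$ is the set of all of them. (Here $\underline{A},\overline{A}$ denote the lower and upper membership functions, not interval endpoints.) For $A,B\in\operatorname{IFN}_2(\mathbb{R})$: $A\le_{KY2}B$ iff $\underline{A}\le_{KY}\underline{B}$ and $\overline{A}\le_{KY}\overline{B}$. A sequence $\{\alpha_n\}\subset(0,1]$ is upper dense if for each $\beta\in(0,1]$ and each $\varepsilon>0$ there is $m$ with $\alpha_m\in[\beta,\beta+\varepsilon)$. For a totally ordered set $(K,\le)$, $\operatorname{seq}(K)=K^{\mathbb{N}_0}$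 with $\mathbb{N}_0=\{0,1,2,\dots\}$, and $\mathfrak a\sqsubseteq\mathfrak b$ means that either $\mathfrak a=\mathfrak b$, or there is $n_0\in\mathbb{N}_0$ with $a_n=b_n$ for all $n<n_0$ and $a_{n_0}<b_{n_0}$. Here $K=\operatorname{int}(\mathbb{R})$ with $\le_{\operatorname{int}}$. The relation $\le_\Phi$ is $A\le_\Phi B\iff\Phi(A)\sqsubseteq\Phi(B)$. *)

(* Defs.v *)
From mathcomp Require Import all_boot all_order all_algebra.
From mathcomp Require Import all_classical all_reals topology normedtype.
From Corelib Require Relation_Definitions.

Set Implicit Arguments.
Unset Strict Implicit.
Unset Printing Implicit Defensive.

Import Order.TTheory GRing.Theory Num.Theory.
Import numFieldNormedType.Exports.

Local Open Scope classical_set_scope.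
Local Open Scope ring_scope.

Section Orders.
Variable T : Type.
Implicit Types le po : T -> T -> Prop.

Definition total_order le : Prop :=
  Relation_Definitions.order T le /\ forall x y, le x y \/ le y x.

Definition refines le po : Prop := forall x y, po x y -> le x y.

Definition admissible po le : Prop := total_order le /\ refines le po.

Definition seq_le le (a b : nat -> T) : Prop :=
  a = b \/
  exists n0 : nat, (forall n, (n < n0)%N -> a n = b n) /\
                   (le (a n0) (b n0) /\ a n0 <> b n0).

End Orders.

Section FuzzyNumbers.
Variable R : realType.

Definition is_segment (S : set R) : Prop :=
  exists a b : R, a <= b /\ S = `[a, b]%classic.

Record segment := Segment {
  segment_set :> set R;
  segmentP : is_segment segment_set }.

(* Kulisch-Miranker order; the endpoints of U and V are unique since both
   sets are nonempty. *)
Definition le_KM (U V : segment) : Prop :=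
  exists a b c d : R,
    [/\ segment_set U = `[a, b]%classic, segment_set V = `[c, d]%classic, a <= c & b <= d].

Record fuzzy_set := FuzzySet {
  membership :> R -> R;
  membership01 : forall x, 0 <= membership x <= 1 }.

Implicit Type F G : fuzzy_set.

Definition pos_cut F (a : R) : set R := [set x | a <= F x].

Definition support F : set R :=
  \bigcup_(a in [set a : R | 0 < a <= 1]) pos_cut F a.

Definition cut F (a : R) : set R :=
  if a == 0 then closure (support F) else pos_cut F a.

Record is_fuzzy_number F : Prop := IsFuzzyNumber {
  cut1_nonempty : cut F 1 !=set0;
  cut0_bounded : bounded_set (cut F 0);
  cut_is_segment : forall a : R, 0 < a <= 1 -> is_segment (cut F a) }.

Record fuzzy_number := FuzzyNumber {
  fuzzy_number_set :> fuzzy_set;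
  fuzzy_numberP : is_fuzzy_number fuzzy_number_set }.

Lemma cut_pos F (a : R) : 0 < a -> cut F a = pos_cut F a.
Proof. by move=> a0; rewrite /cut gt_eqF. Qed.

Lemma closed_is_segment (S : set R) : S !=set0 -> bounded_set S ->
  closed S -> is_interval S -> is_segment S.
Proof.
move=> S0 bS cS iS.
have [M SM] : exists M, forall x, S x -> `|x| <= M.
  have [K [_ /(_ (K + 1)) SK]] := bS; exists (K + 1) => x Sx.
  by apply: SK => //; rewrite ltrDl.
have hu : has_ubound S.
  by exists M => x Sx; apply: le_trans (SM _ Sx); exact: ler_norm.
have hl : has_lbound S.
  by exists (- M) => x Sx; have := SM _ Sx; rewrite ler_norml => /andP[].
have Ssup : S (sup S).
  by rewrite [X in X _](closure_id S).1//; exact: closure_sup.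
have Sinf : S (inf S).
  rewrite [X in X _](closure_id S).1// => B /nbhs_ballP[e /= e0 eB].
  have [x Sx xe] := inf_adherent e0 (conj S0 hl).
  exists x; split=> //; apply: eB; rewrite /ball /= distrC ger0_norm.
    by rewrite ltrBlDl.
  by rewrite subr_ge0; exact: (ge_inf hl Sx).
exists (inf S), (sup S); split; first exact: (ge_inf hl Ssup).
apply/seteqP; split=> x /=.
  move=> Sx; rewrite in_itv /=; apply/andP; split.
    exact: (ge_inf hl Sx).
  exact: (ub_le_sup hu Sx).
by rewrite in_itv /= => /(iS _ _ Sinf Ssup).
Qed.

Lemma support_is_interval F : is_fuzzy_number F -> is_interval (support F).
Proof.
move=> [_ _ h] x y [a /= a01 xa] [b /= b01 yb] z xyz.
wlog suff: / forall c : R, 0 < c <= 1 -> pos_cut F c x -> pos_cut F c y ->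
  support F z.
  move=> {h} H; have [ab|ba] := leP a b.
    by apply: (H a) => //; exact: le_trans ab yb.
  by apply: (H b) => //; exact: le_trans (ltW ba) xa.
move=> c c01 xc yc; have /andP[c0 _] := c01.
exists c => //; have [u [v [_ E]]] := h c c01.
move: E; rewrite cut_pos// => E; move: xc yc; rewrite E /= !in_itv /=.
move: xyz => /andP[xz zy] /andP[ux _] /andP[_ yv].
by rewrite (le_trans ux xz) (le_trans zy yv).
Qed.

Lemma fuzzy_number_cut_segment (F : fuzzy_number) (a : R) :
  0 <= a <= 1 -> is_segment (cut F a).
Proof.
have FN := fuzzy_numberP F.
move=> /andP[]; rewrite le_eqVlt => /predU1P[<- _|a0 a1]; last first.
  by apply: cut_is_segment => //; rewrite a0.
apply: closed_is_segment.
- have [x] := cut1_nonempty FN; rewrite cut_pos// => x1.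
  exists x; rewrite /cut eqxx; apply: subset_closure.
  by exists 1 => //=; rewrite ltr01 lexx.
- exact: cut0_bounded.
- by rewrite /cut eqxx; exact: closed_closure.
- rewrite /cut eqxx; apply/connected_intervalP; apply: connected_closure.
  by apply/connected_intervalP; exact: support_is_interval.
Qed.

Definition cut_segment (F : fuzzy_number) (a : R) (a01 : 0 <= a <= 1) :
  segment := Segment (fuzzy_number_cut_segment F a01).

Definition le_KY (F G : fuzzy_number) : Prop :=
  forall (a : R) (a01 : 0 <= a <= 1),
    le_KM (cut_segment F a01) (cut_segment G a01).

Record IFN2 := MkIFN2 {
  lower : fuzzy_number;
  upper : fuzzy_number;
  lower_le_upper : forall x, lower x <= upper x }.

Definition le_KY2 (A B : IFN2) : Prop :=
  le_KY (lower A) (lower B) /\ le_KY (upper A) (upper B).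

Definition upper_dense (alpha : nat -> R) : Prop :=
  forall b e : R, 0 < b <= 1 -> 0 < e -> exists m, b <= alpha m < b + e.

Lemma level_weaken (a : R) : 0 < a <= 1 -> 0 <= a <= 1.
Proof. by move=> /andP[/ltW -> ->]. Qed.

Definition Phi (alpha : nat -> R) (alpha01 : forall n, 0 < alpha n <= 1)
    (A : IFN2) : nat -> segment := fun k =>
  cut_segment (if odd k then lower A else upper A)
              (level_weaken (alpha01 k./2)).

Definition le_Phi (le_int : segment -> segment -> Prop) (alpha : nat -> R)
    (alpha01 : forall n, 0 < alpha n <= 1) (A B : IFN2) : Prop :=
  seq_le le_int (Phi alpha01 A) (Phi alpha01 B).

End FuzzyNumbers.

(* Main.v *)
Require Import Defs.
From mathcomp Require Import all_boot all_order all_algebra.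
From mathcomp Require Import all_classical all_reals topology normedtype.
Import Order.TTheory GRing.Theory Num.Theory.
Local Open Scope ring_scope.

(** The lexicographic order on sequences over a totally ordered set is total
    and contains the pointwise order, so everything pulls back along [Phi] once
    [Phi] is injective.  Injectivity: if [G x < F x], upper density applied at
    the midpoint gives a level [alpha m] in the interval from the midpoint to
    [F x], and [x] lies in the [alpha m]-cut of [F] but not in that of [G]. *)

Section Lexicographic.
Context {T : Type} {le : T -> T -> Prop}.
Hypothesis le_total : total_order le.

(** The least index of disagreement, which exists because [nat] is well-ordered. *)
Lemma first_difference (a b : nat -> T) : a <> b ->
  exists n0 : nat, (forall n, (n < n0)%N -> a n = b n) /\ a n0 <> b n0.
Proof.
move=> ab; have [n abn] : exists n, `[< a n <> b n >].
  by apply: contra_notP ab => /forallNP H; apply/funext => n;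
    apply: contrapT => abn; apply: (H n); apply/asboolP.
have ex : exists n, `[< a n <> b n >] by exists n.
have [m /asboolP abm mmin] := ex_minnP ex.
exists m; split=> // k km; apply: contrapT => abk.
by have := mmin k; rewrite leqNgt km; move=> /(_ (asboolT abk)).
Qed.

Lemma seq_le_pointwise (a b : nat -> T) :
  (forall n, le (a n) (b n)) -> seq_le le a b.
Proof.
move=> ab; have [|/first_difference[n0 [eqn neqn]]] := pselect (a = b).
  by left.
by right; exists n0.
Qed.

Lemma seq_le_refl : Relation_Definitions.reflexive (nat -> T) (seq_le le).
Proof. by left. Qed.

(** The smaller of the two first-difference indices decides [a] against [c], since the other pair
    still agrees there. *)
Lemma seq_le_trans : Relation_Definitions.transitive (nat -> T) (seq_le le).
Proof.
have [[_ tr anti] _] := le_total.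
move=> a b c [->//|[n [abE [abn nab]]]] [<-|[m [bcE [bcm nbc]]]].
  by right; exists n.
right; have [nm|mn|nm] := ltngtP n m.
- exists n; split; last by rewrite -bcE.
  by move=> k kn; rewrite abE// bcE// (ltn_trans kn).
- exists m; split; last by rewrite abE.
  by move=> k km; rewrite abE ?bcE// (ltn_trans km).
- subst m; exists n; split; first by move=> k kn; rewrite abE ?bcE.
  split; first exact: tr bcm.
  by move=> ac; apply: nab; apply: anti => //; rewrite ac.
Qed.

Lemma seq_le_antisym : Relation_Definitions.antisymmetric (nat -> T) (seq_le le).
Proof.
have [[_ _ anti] _] := le_total.
move=> a b [//|[n [abE [abn nab]]]] [//|[m [baE [bam nba]]]].
have [nm|mn|nm] := ltngtP n m.
- by case: nab; rewrite baE.
- by case: nba; rewrite abE.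
- by subst m; case: nab; apply: anti.
Qed.

Lemma seq_le_total (a b : nat -> T) : seq_le le a b \/ seq_le le b a.
Proof.
have [_ tot] := le_total.
have [->|/first_difference[n [eqn neqn]]] := pselect (a = b).
  by left; exact: seq_le_refl.
have [abn|ban] := tot (a n) (b n); [left|right]; right; exists n; split=> //.
- by move=> k /eqn ->.
- by split=> // /esym.
Qed.

Lemma seq_le_total_order : total_order (seq_le le).
Proof.
split; last exact: seq_le_total.
by split; [exact: seq_le_refl|exact: seq_le_trans|exact: seq_le_antisym].
Qed.

End Lexicographic.

(** Injectivity supplies antisymmetry; the other laws transfer directly. *)
Lemma total_order_preimage {S T : Type} (le : T -> T -> Prop) (f : S -> T) :
  total_order le -> injective f -> total_order (fun x y => le (f x) (f y)).
Proof.
move=> [[rf tr anti] tot] f_inj; split; last by move=> x y; exact: tot.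
split; first by move=> x; exact: rf.
- by move=> x y z; exact: tr.
- by move=> x y xy yx; apply: f_inj; exact: anti.
Qed.

Section Injectivity.
Context {R : realType}.

Lemma fuzzy_number_ext (F G : fuzzy_number R) : F =1 G -> F = G.
Proof.
case: F G => [[f f01] pf] [[g g01] pg] /= /funext fg; subst g.
have e := Prop_irrelevance f01 g01; subst g01.
by rewrite (Prop_irrelevance pf pg).
Qed.

Lemma IFN2_ext (A B : IFN2 R) : lower A = lower B -> upper A = upper B -> A = B.
Proof.
case: A B => [l u lu] [l' u' lu'] /= el eu; subst l' u'.
by rewrite (Prop_irrelevance lu lu').
Qed.

Context {alpha : nat -> R}.
Hypotheses (alpha01 : forall n, 0 < alpha n <= 1)
  (alpha_dense : upper_dense alpha).

Lemma le_of_subset_cuts (F G : fuzzy_set R) :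
  (forall n x, cut F (alpha n) x -> cut G (alpha n) x) ->
  forall x, F x <= G x.
Proof.
move=> FG x; rewrite leNgt; apply/negP => GF.
have /andP[G0 _] := membership01 G x; have /andP[_ F1] := membership01 F x.
(* Upper density gives only [b <= alpha m], so [b] must already lie strictly above [G x]; this also
   makes [b] positive when [G x = 0]. *)
have [Gb bF] := midf_lt GF; set b := (G x + F x) / 2 in Gb bF.
have b01 : 0 < b <= 1.
  by rewrite (le_lt_trans G0 Gb) (le_trans (ltW bF) F1).
(* With this width the window [[b, b + e)] ends exactly at [F x]. *)
have e0 : 0 < F x - b by rewrite subr_gt0.
have [m] := alpha_dense _ _ b01 e0.
rewrite addrC subrK => /andP[bm mF].
have /andP[m0 _] := alpha01 m.
have := FG m x; rewrite !cut_pos// => /(_ (ltW mF)); rewrite /pos_cut /= => mG.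
by have := lt_le_trans Gb (le_trans bm mG); rewrite ltxx.
Qed.

Lemma fuzzy_number_eq_cuts (F G : fuzzy_number R) :
  (forall n, cut F (alpha n) = cut G (alpha n)) -> F = G.
Proof.
move=> FG; apply: fuzzy_number_ext => x; apply/eqP; rewrite eq_le.
by rewrite !le_of_subset_cuts// => n y; rewrite FG.
Qed.

Lemma Phi_inj : injective (Phi alpha01).
Proof.
(* Passing to underlying sets discards the proofs bundled in the segments and leaves equalities of
   cuts. *)
move=> A B /(congr1 (fun s n => segment_set (s n))) AB.
apply: IFN2_ext; apply: fuzzy_number_eq_cuts => n.
(* Odd entries recover the lower cuts, even entries the upper ones. *)
- have := congr1 (@^~ n.*2.+1) AB.
  by rewrite /Phi /= odd_double /= uphalf_double.
- have := congr1 (@^~ n.*2) AB.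
  by rewrite /Phi /= odd_double /= doubleK.
Qed.

End Injectivity.

Theorem theorem6p7 (R : realType) (le_int : segment R -> segment R -> Prop)
    (le_int_adm : admissible (@le_KM R) le_int)
    (alpha : nat -> R) (alpha01 : forall n : nat, 0 < alpha n <= 1)
    (alpha_dense : upper_dense alpha) :
  admissible (@le_KY2 R) (le_Phi le_int alpha01).
Proof.
have [le_total le_ref] := le_int_adm; split.
  apply: (total_order_preimage (seq_le le_int) (Phi alpha01)).
  - exact: seq_le_total_order.
  - exact: Phi_inj.
(* Each entry of [Phi] is a cut of one membership function, so [le_KY2] gives [le_KM], hence
   [le_int], entry by entry. *)
move=> A B [lowAB uppAB]; apply: seq_le_pointwise => k; apply: le_ref.
by rewrite /Phi; case: (odd k); [exact: lowAB|exact: uppAB].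
Qed.
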